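(* Let $\mathcal I\subseteq\mathbb N$ be an index set and let $(F_S)$, indexed by the finite nonempty sets $S\subseteq\mathcal I$, be a family such that every $F_S:[0,\infty)^S\to[0,\infty)$ is an admissible pointwise $e$-process merger and $$F_B(x_B)\le F_S\big(x_B,\mathbf 1_{S\setminus B}\big)\qquad\text{for all finite nonempty }B\subseteq S\subseteq\mathcal I\text{ and every }x_B\in[0,\infty)^B .$$ Suppose in addition that every $F_S$ is symmetric in its coordinates. If $\mathcal I$ is countably infinite, then $F_S(x_S)=1$ for every finite nonempty $S$ and every $x_S\in[0,\infty)^S$. (Thus there is no nontrivial symmetric, admissible, arbitrary-dependence, pointwise merger family that is coherent over an unbounded hypothesis horizon.) If instead $\mathcal I$ has finite size $M$, then there is a constant $c$ with $0\le c\le1/M$ such that $F_S(x_S)=1+c\sum_{i\in S}(x_i-1)$ for every nonempty $S\subseteq\mathcal I$; that is, all the coordinate weights $w_i$ equal $c$.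
   Context: Here $(x_B,\mathbf 1_{S\setminus B})\in[0,\infty)^S$ is the vector whose coordinates in $B$ are those of $x_B$ and whose coordinates in $S\setminus B$ all equal one. The coordinate weights $w_i\ge0$ (with $\sum_{i\in\mathcal I}w_i\le1$) are the unique ones in the representation $F_S(x_S)=1+\sum_{i\in S}w_i(x_i-1)$ that holds for such coherent admissible families. A nonnegative adapted process $E=(E_t)_{t\in\mathbb N_0}$ on a filtered measurable space with filtration $(\mathcal F_t)_{t\in\mathbb N_0}$ is an $H$-$e$-process, for a null hypothesis $H$ (a set of probability measures), if $\mathbb E_P[E_\tau]\le1$ for every $P\in H$ and every $(\mathcal F_t)$-stopping time $\tau$ with $P(\tau<\infty)=1$. For a finite nonempty set $S$, an increasing (coordinatewise nondecreasing) Borel map $F:[0,\infty)^S\to[0,\infty)$ is a pointwise $e$-process merger if, for every filtered statistical model (discrete-time filtered measurable space with a family of probability measures), every null hypothesis $H$, and every tuple $(M^i)_{i\in S}$ of $H$-$e$-processes in the same filtration, the process $t\mapsto F((M^i_t)_{i\in S})$ is an $H$-$e$-process. A pointwise $e$-process merger $F$ is admissible if there is no other pointwise $e$-process merger $G$ on the same domain with $G\ge F$ everywhere and $G>F$ at some point. *)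

(* Defs.v *)
From mathcomp Require Import all_boot all_order all_algebra all_fingroup.
From mathcomp Require Import finmap.
From mathcomp Require Import all_classical all_reals all_analysis.
Import Order.TTheory GRing.Theory Num.Theory numFieldNormedType.Exports.

Set Implicit Arguments.
Unset Strict Implicit.
Unset Printing Implicit Defensive.

Local Open Scope classical_set_scope.
Local Open Scope ring_scope.

Section EProcess.
Context (R : realType) (d : measure_display) (T : measurableType d).

Definition filtration (Fil : nat -> set (set T)) : Prop :=
  [/\ forall t, sigma_algebra setT (Fil t),
      forall t, Fil t `<=` measurable &
      forall s t, (s <= t)%N -> Fil s `<=` Fil t].

Definition adapted (Fil : nat -> set (set T)) (E : nat -> T -> R) : Prop :=
  forall t (B : set R), measurable B -> Fil t (E t @^-1` B).

(* Random times take values in [option nat]; [None] stands for +oo. *)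
Definition stopping_time (Fil : nat -> set (set T)) (tau : T -> option nat) :
    Prop :=
  forall t, Fil t [set w | exists2 s, tau w = Some s & (s <= t)%N].

Definition finite_time (tau : T -> option nat) : set T := [set w | tau w].

(* The value 0 on [tau = +oo] is a convention without effect below, where
   tau is almost surely finite. *)
Definition stopped (E : nat -> T -> R) (tau : T -> option nat) (w : T) : R :=
  if tau w is Some t then E t w else 0.

Definition e_process (Fil : nat -> set (set T)) (H : set (probability T R))
    (E : nat -> T -> R) : Prop :=
  [/\ forall t w, 0 <= E t w,
      adapted Fil E &
      forall (P : probability T R) (tau : T -> option nat),
        H P -> stopping_time Fil tau -> P (finite_time tau) = 1%E ->
        ('E_P[stopped E tau] <= 1)%E].

End EProcess.

Section Merger.
Context (R : realType) (S : finType).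

(* [0, oo)^S.  Maps [0, oo)^S -> [0, oo) are represented by functions
   (S -> R) -> R, of which only the restriction to [orthant] matters. *)
Definition orthant : set (S -> R) := [set x | forall i, 0 <= x i].

(* R^S with the Borel sigma-algebra of the product topology. *)
Definition borel_prod := g_sigma_algebraType (@open {ptws S -> R}).

Definition pointwise_merger (F : (S -> R) -> R) : Prop :=
  [/\ forall x, orthant x -> 0 <= F x,
      forall x y, orthant x -> orthant y -> (forall i, x i <= y i) -> F x <= F y,
      measurable_fun (orthant : set borel_prod) (F : borel_prod -> R) &
      forall (d : measure_display) (T : measurableType d)
        (Fil : nat -> set (set T)) (H : set (probability T R))
        (M : S -> nat -> T -> R),
        filtration Fil -> (forall i, e_process Fil H (M i)) ->
        e_process Fil H (fun t w => F (fun i => M i t w))].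

Definition admissible_merger (F : (S -> R) -> R) : Prop :=
  pointwise_merger F /\
  ~ exists G : (S -> R) -> R,
      [/\ pointwise_merger G, forall x, orthant x -> F x <= G x &
          exists2 x, orthant x & F x < G x].

Definition symmetric_map (F : (S -> R) -> R) : Prop :=
  forall (s : {perm S}) x, orthant x -> F (fun i => x (s i)) = F x.

End Merger.

Section Family.
Context (R : realType) (I : set nat).

Definition fin_index (S : {fset nat}) : Prop :=
  S != fset0 /\ [set` S] `<=` I.

(* The vector (x_B, 1_{S \ B}). *)
Definition extend1 (B S : {fset nat}) (x : B -> R) : S -> R :=
  fun i => if insub (val i) is Some j then x j else 1.

Definition coherent (F : forall S : {fset nat}, (S -> R) -> R) : Prop :=
  forall B S : {fset nat}, B != fset0 -> (B `<=` S)%fset -> fin_index S ->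
  forall x : B -> R, orthant x ->
    F B x <= F S (extend1 x).

Definition coordinate_weights (F : forall S : {fset nat}, (S -> R) -> R)
    (w : nat -> R) : Prop :=
  [/\ forall i, I i -> 0 <= w i,
      (\esum_(i in I) (w i)%:E <= 1)%E &
      forall S : {fset nat}, fin_index S -> forall x : S -> R, orthant x ->
        F S x = 1 + \sum_(i : S) w (val i) * (x i - 1)].

End Family.

Arguments extend1 {R B} S x _.

(* Main.v *)
From HB Require Import structures.
Require Import Defs.
From mathcomp Require Import all_boot all_order all_algebra all_fingroup.
From mathcomp Require Import finmap.
From mathcomp Require Import all_classical all_reals all_analysis.
From mathcomp Require Import measurable_realfun ring lra.
Import Order.TTheory GRing.Theory Num.Theory numFieldNormedType.Exports.

Set Implicit Arguments.
Unset Strict Implicit.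
Unset Printing Implicit Defensive.

Local Open Scope classical_set_scope.
Local Open Scope ring_scope.

(** Merging several dependent [e]-processes pointwise by a symmetric map [F] is
    governed by one-dimensional data: the excess [\sum_i (x i - 1)] of a point.

    Let [x] and [y] have excess of opposite signs, and draw [x] or [y] with
    probabilities that make the mean excess nonpositive, after which the
    coordinates are shuffled by a uniform random permutation.  Each shuffled
    coordinate is then a variable of mean at most 1, that is, an [e]-process
    constant in time, while symmetry makes [F] blind to the shuffle.  The merger
    property therefore bounds the average of [F x] and [F y] by 1
    ([symmetric_merger_two_point]).  This says that every chord slope
    [(F y - 1) / excess y] from the positive side is below every chord slope
    [(1 - F x) / - excess x] from the negative side, so a number [c] between
    them gives the affine bound [F x <= 1 + c * excess x]
    ([symmetric_merger_le_affine]); evaluation at 0 gives [c <= 1 / #|S|].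

    Conversely [1 + c * excess x] is a weighted arithmetic mean of 1 and the
    coordinates, and linearity of expectation makes it a merger
    ([affine_pointwise_merger]).  An admissible symmetric [F] is thus equal to
    it.

    For a coherent family, comparing [F_B] with [F_S] at the constant vectors 0
    and 2 forces the slopes of [B] and [S] to agree
    ([coherent_affine_slope]).  So one slope [c] serves all index sets and
    satisfies [c * #|S| <= 1] for each of them: it is at most [1 / M] when there
    are [M] indices, and 0 when there are infinitely many. *)

(** * Testing a merger on finite probability spaces *)

Section FiniteProbability.
Context (R : realType) (N : nat) (q : nat -> {nonneg R}).

Definition weighted_diracs : set nat -> \bar R :=
  msum (fun k => mscale (q k) (@dirac _ nat k R)) N.

HB.instance Definition _ := Measure.on weighted_diracs.

Hypothesis q_sum1 : \sum_(k < N) (q k)%:num = 1.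

Let weighted_diracsT : weighted_diracs setT = 1%E.
Proof.
rewrite -q_sum1 -sumEFin; apply: eq_bigr => k _.
by rewrite /= /mscale /= diracT mule1.
Qed.

HB.instance Definition _ :=
  Measure_isProbability.Build _ _ R weighted_diracs weighted_diracsT.

Definition weighted_diracs_probability : probability nat R := weighted_diracs.

Lemma expectation_weighted_diracs (f : nat -> R) : (forall k, 0 <= f k) ->
  ('E_weighted_diracs_probability[f] = (\sum_(k < N) (q k)%:num * f k)%:E)%E.
Proof.
move=> f0; rewrite unlock /weighted_diracs_probability /=.
rewrite ge0_integral_measure_sum//; last by move=> k _; rewrite lee_fin.
rewrite -sumEFin; apply: eq_bigr => k _.
rewrite ge0_integral_mscale//; last by move=> j _; rewrite lee_fin.
by rewrite integral_dirac// diracT mul1e.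
Qed.

End FiniteProbability.

Section JensenMerger.
Context (R : realType) (S : finType).

(** With the full sigma-algebra at every time, the random variables [X _ i] are
    [e]-processes constant in time: stopping one only replaces its value by 0 on
    the event that the stopping time is infinite, which cannot raise the mean.
    Stopping the merged process at time 0 gives the bound. *)
Lemma pointwise_merger_nat_mixture (F : (S -> R) -> R) (N : nat)
    (p : nat -> {nonneg R}) (X : nat -> S -> R) :
  pointwise_merger F -> (forall k, orthant (X k)) ->
  \sum_(k < N) (p k)%:num = 1 ->
  (forall i, \sum_(k < N) (p k)%:num * X k i <= 1) ->
  \sum_(k < N) (p k)%:num * F (X k) <= 1.
Proof.
move=> [F0 _ _ Fmerge] X0 p1 Xle.
pose P := weighted_diracs_probability p1.
pose Fil (_ : nat) : set (set nat) := measurable.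
have Fil_filtration : filtration Fil by split.
have M_e_process i : e_process Fil [set P] (fun _ k => X k i).
  split=> [t k|//|P' tau -> _ _]; first exact: X0.
  have stopped_le k : 0 <= stopped (fun _ k => X k i) tau k <= X k i.
    by rewrite /stopped; case: (tau k) => [_|]; rewrite ?lexx X0.
  rewrite expectation_weighted_diracs; last first.
    by move=> k; case/andP: (stopped_le k).
  rewrite lee_fin (le_trans _ (Xle i))//; apply: ler_sum => k _.
  by apply: ler_wpM2l => //; case/andP: (stopped_le k).
have [_ _ /(_ P (fun=> Some 0%N))] :=
  Fmerge _ _ _ _ _ Fil_filtration M_e_process.
rewrite expectation_weighted_diracs => [|k]; last exact/F0/X0.
rewrite lee_fin; apply => //.
have -> : finite_time (fun _ : nat => Some 0%N) = setT by apply/seteqP.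
exact: probability_setT.
Qed.

(** The form used below: the sample space may be any finite type, which is
    transported to the natural numbers through its enumeration. *)
Lemma pointwise_merger_mixture (F : (S -> R) -> R) (J : finType)
    (p : J -> R) (X : J -> S -> R) :
  pointwise_merger F -> (forall j, 0 <= p j) -> (forall j, orthant (X j)) ->
  \sum_j p j = 1 -> (forall i, \sum_j p j * X j i <= 1) ->
  \sum_j p j * F (X j) <= 1.
Proof.
move=> Fm p0 X0 p1 Xle.
have [j0 _|J0] := pickP (@predT J); last first.
  by move: p1; rewrite big1 => [/eqP|j]; [rewrite eq_sym oner_eq0|have := J0 j].
have sumE (f : J -> R) : \sum_j f j = \sum_(k < #|J|) f (nth j0 (enum J) k).
  by rewrite -big_enum (big_nth j0) -cardE big_mkord.
rewrite sumE in p1; rewrite sumE.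
have := @pointwise_merger_nat_mixture F #|J|
  (fun k => NngNum (p0 (nth j0 (enum J) k))) (fun k => X (nth j0 (enum J) k)).
by apply => // i; have := Xle i; rewrite sumE.
Qed.

End JensenMerger.

(** * Symmetric mergers lie below an affine one *)

Section SymmetricMerger.
Context (R : realType) (S : finType).

Definition excess (x : S -> R) : R := \sum_i (x i - 1).

Lemma excessE (x : S -> R) : excess x = \sum_i x i - #|S|%:R.
Proof. by rewrite /excess sumrB sumr_const. Qed.

(** A coordinate of a uniformly shuffled vector has the mean of the vector as
    its expectation: by transposing coordinates the sum does not depend on [i],
    and the sum over all [i] is permutation invariant. *)
Lemma sum_perm_coordinate (x : S -> R) (i : S) :
  #|S|%:R * (\sum_(s : {perm S}) x (s i)) = #|{perm S}|%:R * \sum_j x j.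
Proof.
have coord_indep j : \sum_(s : {perm S}) x (s j) = \sum_(s : {perm S}) x (s i).
  rewrite (reindex_inj (mulgI (tperm i j))) /=.
  by apply: eq_bigr => s _; rewrite permM tpermR.
transitivity (\sum_j \sum_(s : {perm S}) x (s j)).
  by rewrite (eq_bigr _ (fun j _ => coord_indep j)) sumr_const mulr_natl.
rewrite exchange_big /= (eq_bigr (fun=> \sum_j x j)) => [|s _].
  by rewrite sumr_const mulr_natl.
by rewrite [RHS](reindex_inj (@perm_inj _ s)).
Qed.

(** The sample space consists of a permutation, uniform and independent of a
    biased coin which selects [x] or [y]. *)
Lemma symmetric_merger_two_point (F : (S -> R) -> R) (p q : R) (x y : S -> R) :
  pointwise_merger F -> symmetric_map F -> 0 <= p -> 0 <= q -> p + q = 1 ->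
  orthant x -> orthant y -> p * excess x + q * excess y <= 0 ->
  p * F x + q * F y <= 1.
Proof.
move=> Fm Fsym p0 q0 pq1 x0 y0 pq_excess.
have N_gt0 : 0 < #|{perm S}|%:R :> R.
  by rewrite ltr0n; apply/card_gt0P; exists 1%g.
pose w (j : {perm S} * bool) : R := (if j.2 then p else q) / #|{perm S}|%:R.
pose X (j : {perm S} * bool) i := (if j.2 then x else y) (j.1 i).
have sum_wE (f : {perm S} * bool -> R) : \sum_j w j * f j =
    (p * (\sum_s f (s, true)) + q * (\sum_s f (s, false))) / #|{perm S}|%:R.
  rewrite (eq_bigr (fun j => w (j.1, j.2) * f (j.1, j.2))) => [|[]//].
  rewrite -(pair_bigA _ (fun s b => w (s, b) * f (s, b))) /=.
  under eq_bigr do rewrite big_bool /w /=.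
  by rewrite big_split /= -!mulr_sumr mulrDl ![_ * _ / _]mulrAC.
have := @pointwise_merger_mixture R S F _ w X Fm.
have X0 j : orthant (X j) by move=> i; rewrite /X; case: j.2.
have w0 j : 0 <= w j by rewrite /w divr_ge0 ?ler0n//; case: j.2.
have w1 : \sum_j w j = 1.
  under eq_bigr do rewrite -[w _]mulr1.
  by rewrite sum_wE !sumr_const -mulrDl pq1 mul1r divff ?gt_eqF.
move=> /(_ w0 X0 w1); rewrite !sum_wE.
have FX s b : F (X (s, b)) = F (if b then x else y).
  by apply: Fsym; case: b.
rewrite (eq_bigr _ (fun s _ => FX s true)) (eq_bigr _ (fun s _ => FX s false)).
rewrite !sumr_const -!(mulr_natr (F _)) !mulrA -mulrDl mulfK ?gt_eqF//.
apply=> i; rewrite sum_wE /X /=.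
have n_gt0 : 0 < #|S|%:R :> R by rewrite ltr0n; apply/card_gt0P; exists i.
rewrite ler_pdivrMr// mul1r -(ler_pM2l n_gt0).
rewrite mulrDr !(mulrCA #|S|%:R) !sum_perm_coordinate.
rewrite !(mulrCA _ #|{perm S}|%:R) -mulrDr (mulrC #|S|%:R) ler_pM2l//.
have pq_n : p * #|S|%:R + q * #|S|%:R = #|S|%:R by rewrite -mulrDl pq1 mul1r.
by move: pq_excess; rewrite !excessE !mulrBr; lra.
Qed.

(** The slope is the infimum of the chord slopes to the left of excess 0; the
    two-point inequality makes the chord slopes to the right lower bounds of
    them. *)
Lemma symmetric_merger_le_affine (F : (S -> R) -> R) :
  (0 < #|S|)%N -> pointwise_merger F -> symmetric_map F ->
  exists c : R, [/\ 0 <= c, c * #|S|%:R <= 1 &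
    forall x, orthant x -> F x <= 1 + c * excess x].
Proof.
move=> S_gt0 Fm Fsym.
have [F0 _ _ _] := Fm.
have n_gt0 : 0 < #|S|%:R :> R by rewrite ltr0n.
have F_le1 x : orthant x -> excess x <= 0 -> F x <= 1.
  move=> x0 ex.
  have := @symmetric_merger_two_point F 1 0 x x Fm Fsym.
  by rewrite !mul1r !mul0r !addr0; apply.
pose slopes : set R :=
  [set (1 - F x) / - excess x | x in [set x | orthant x /\ excess x < 0]].
have orthant0 : orthant (fun=> 0 : R) by move=> i.
have excess0 : excess (fun=> 0 : R) = - #|S|%:R.
  by rewrite excessE big1 // sub0r.
have slope0 : slopes ((1 - F (fun=> 0)) / #|S|%:R).
  by exists (fun=> 0) => /=; rewrite excess0 ?opprK// oppr_lt0.
have slopes_ge0 : lbound slopes 0.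
  move=> _ [x [x0 ex] <-].
  by rewrite divr_ge0 ?subr_ge0 ?F_le1 ?oppr_ge0// ltW.
exists (inf slopes); split.
- by apply: lb_le_inf => //; exists ((1 - F (fun=> 0)) / #|S|%:R).
- rewrite -ler_pdivlMr// (le_trans (ge_inf _ slope0))//; first by exists 0.
  by rewrite ler_pM2r ?invr_gt0// gerBl F0.
move=> y y0; have [ey|ey|ey] := ltgtP (excess y) 0.
- have : inf slopes <= (1 - F y) / - excess y.
    by apply: ge_inf; [exists 0|exists y].
  rewrite ler_pdivlMr ?oppr_gt0//; lra.
- have : (F y - 1) / excess y <= inf slopes.
    apply: lb_le_inf => [|_ [x [x0 ex] <-]].
      by exists ((1 - F (fun=> 0)) / #|S|%:R).
    rewrite ler_pdivrMr// mulrAC ler_pdivlMr ?oppr_gt0//.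
    have d_gt0 : 0 < excess y - excess x by lra.
    (* The weights are those for which the mean excess is exactly 0. *)
    have : excess y / (excess y - excess x) * F x
        + - excess x / (excess y - excess x) * F y <= 1.
      apply: (symmetric_merger_two_point Fm Fsym) => //.
      - by rewrite divr_ge0 ?ltW.
      - by rewrite divr_ge0 ?oppr_ge0 ?ltW.
      - by rewrite -mulrDl divff ?gt_eqF.
      - rewrite [leLHS](_ : _ = 0)//; field; exact: lt0r_neq0.
    by rewrite ![_ / _ * _]mulrAC -mulrDl ler_pdivrMr// mul1r; lra.
  by rewrite ler_pdivrMr//; lra.
- by rewrite ey mulr0 addr0 F_le1 ?ey.
Qed.

End SymmetricMerger.

(** * Affine maps are mergers *)

Section Stopping.
Context (R : realType) (d : measure_display) (T : measurableType d).

(** Measurability is what makes the expectations of stopped processes additive;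
    it comes from cutting along the countably many values of [tau]. *)
Lemma measurable_stopped (Fil : nat -> set (set T)) (E : nat -> T -> R)
    (tau : T -> option nat) :
  filtration Fil -> adapted Fil E -> stopping_time Fil tau ->
  measurable_fun setT (stopped E tau).
Proof.
move=> [_ Fil_measurable _] E_adapted tau_stopping _ B mB; rewrite setTI.
pose before t := [set w | exists2 s, tau w = Some s & (s <= t)%N].
have mbefore t : measurable (before t) by exact/Fil_measurable/tau_stopping.
pose at_time t := before t `\` \bigcup_(s in [set s | (s < t)%N]) before s.
have at_timeE t w : at_time t w <-> tau w = Some t.
  split=> [[[s ws st] nbefore]|wt]; last first.
    split; first by exists t.
    by move=> [s /= st [r]]; rewrite wt => -[<-]; rewrite leqNgt st.
  move: st; rewrite leq_eqVlt => /predU1P[<-//|st].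
  by case: nbefore; exists s => //; exists s.
have -> : stopped E tau @^-1` B = \bigcup_t (at_time t `&` E t @^-1` B) `|`
    (~` (\bigcup_t before t) `&` [set _ | B 0]).
  apply/seteqP; split=> [w|w [[t _ [/at_timeE wt]]|[nbefore B0]]].
  - rewrite /= /stopped; case wt: (tau w) => [t|] Bw; [left|right].
      by exists t => //; split=> //; apply/at_timeE.
    by split=> // -[t _ [s]]; rewrite wt.
  - by rewrite /= /stopped wt.
  - rewrite /= /stopped; case wt: (tau w) => [t|]//.
    by case: nbefore; exists t => //; exists t.
apply: measurableU; last first.
  apply: measurableI; first exact/measurableC/bigcupT_measurable.
  by rewrite -[X in measurable X]setTI; exact: (@measurable_cst _ _ T R setT 0).
apply: bigcupT_measurable => t; apply: measurableI.
  by apply: measurableD => //; exact: bigcup_measurable.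
exact/Fil_measurable/E_adapted.
Qed.

End Stopping.

Section AffineMerger.
Context (R : realType) (S : finType).

Lemma measurable_coordinate (i : S) :
  measurable_fun setT (fun x : borel_prod R S => x i).
Proof.
apply: (measurability _ (measurable_realfun.RGenOpens.measurableE R)) => //.
move=> _ [_ [a [b ->]] <-]; rewrite setTI; apply: sub_sigma_algebra.
apply: open_comp; last exact: interval_open.
by move=> x _; exact: (@proj_continuous S (fun=> R) i x).
Qed.

(** Written as [(1 - c * #|S|) + c * \sum_i x i], the map has nonnegative
    coefficients summing to 1, so expectation bounds pass through it. *)
Lemma affine_pointwise_merger (c : R) : 0 <= c -> c * #|S|%:R <= 1 ->
  pointwise_merger (fun x : S -> R => 1 + c * \sum_i (x i - 1)).
Proof.
move=> c0 cn.
have affineE (x : S -> R) :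
    1 + c * \sum_i (x i - 1) = 1 - c * #|S|%:R + c * \sum_i x i.
  by rewrite sumrB sumr_const mulrBr; ring.
under eq_fun do rewrite affineE.
have cst_ge0 : 0 <= 1 - c * #|S|%:R by rewrite subr_ge0.
have affine_ge0 (x : S -> R) : orthant x ->
    0 <= 1 - c * #|S|%:R + c * \sum_i x i.
  by move=> x0; rewrite addr_ge0// mulr_ge0// sumr_ge0.
split=> //.
- by move=> x y _ _ xy; rewrite lerD2l ler_wpM2l// ler_sum.
- apply: measurable_funTS; apply: measurable_funD => //.
  apply: measurable_funM => //; apply: measurable_sum => i.
  exact: measurable_coordinate.
move=> d T Fil H M Fil_filtration M_e_process.
have M0 i t w : 0 <= M i t w by case: (M_e_process i).
have M_adapted i : adapted Fil (M i) by case: (M_e_process i).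
have G_adapted : adapted Fil (fun t w => 1 - c * #|S|%:R + c * \sum_i M i t w).
  move=> t; have [Fil_sigma _ _] := Fil_filtration.
  (* The type [g_sigma_algebraType (Fil t)] has exactly [Fil t] as its
     measurable sets, so adaptedness at time [t] is measurability there. *)
  have mM i : measurable_fun setT (M i t : g_sigma_algebraType (Fil t) -> R).
    move=> _ B mB; rewrite setTI.
    by rewrite measurable_g_measurableTypeE//; exact: M_adapted.
  have mG : measurable_fun setT (fun w : g_sigma_algebraType (Fil t) =>
      1 - c * #|S|%:R + c * \sum_i M i t w).
    apply: measurable_funD => //; apply: measurable_funM => //.
    exact: measurable_sum.
  move=> B mB; have := mG measurableT _ mB.
  by rewrite setTI measurable_g_measurableTypeE.
split=> [t w|//|P tau HP tau_stopping tau_finite].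
  by apply: affine_ge0 => i; exact: M0.
have mstopped i : measurable_fun setT (stopped (M i) tau).
  exact: measurable_stopped Fil_filtration (M_adapted i) tau_stopping.
have stopped0 i w : 0 <= stopped (M i) tau w.
  by rewrite /stopped; case: (tau w).
have stopped_le1 i : (\int[P]_w (stopped (M i) tau w)%:E <= 1)%E.
  case: (M_e_process i) => _ _ /(_ P tau HP tau_stopping tau_finite).
  by rewrite unlock.
rewrite unlock.
(* Only an inequality: where [tau] is infinite the stopped merged process is 0,
   while the affine map of the stopped processes is its constant term. *)
apply: (@le_trans _ _ (\int[P]_w ((1 - c * #|S|%:R)%:E +
    c%:E * \sum_i (stopped (M i) tau w)%:E))%E).
  apply: ge0_le_integral => //.
  - move=> w _; rewrite lee_fin /stopped; case: (tau w) => // t.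
    by apply: affine_ge0 => i; exact: M0.
  - apply/measurable_EFinP.
    exact: measurable_stopped Fil_filtration G_adapted tau_stopping.
  - apply: emeasurable_funD => //; apply: emeasurable_funM => //.
    by apply: emeasurable_sum => i; exact/measurable_EFinP.
  - move=> w _; rewrite sumEFin -EFinM -EFinD lee_fin /stopped.
    by case: (tau w) => [//|]; rewrite big1// mulr0 addr0.
have mEstopped i : measurable_fun setT (fun w => (stopped (M i) tau w)%:E).
  exact/measurable_EFinP.
have Estopped0 i w : (0 <= (stopped (M i) tau w)%:E)%E by rewrite lee_fin.
rewrite ge0_integralD//; last 2 first.
- by move=> w _; rewrite mule_ge0// sume_ge0.
- by apply: emeasurable_funM => //; exact: emeasurable_sum.
rewrite integral_cst// [X in (_ * X)%E]probability_setT mule1.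
rewrite ge0_integralZl//; last 2 first.
- exact: emeasurable_sum.
- by move=> w _; rewrite sume_ge0.
rewrite ge0_integral_sum//.
apply: (@le_trans _ _ ((1 - c * #|S|%:R)%:E + c%:E * \sum_(i : S) 1)%E).
  by rewrite leeD2l// lee_wpmul2l ?lee_fin//; exact: lee_sum.
by rewrite sumEFin -EFinM -EFinD lee_fin sumr_const subrK.
Qed.

End AffineMerger.

(** * Admissible symmetric families *)

Section AdmissibleSymmetric.
Context (R : realType) (S : finType).

Lemma admissible_symmetric_affine (F : (S -> R) -> R) :
  (0 < #|S|)%N -> admissible_merger F -> symmetric_map F ->
  exists c : R, [/\ 0 <= c, c * #|S|%:R <= 1 &
    forall x, orthant x -> F x = 1 + c * excess x].
Proof.
move=> S_gt0 [Fm Fmax] Fsym.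
have [c [c0 cn F_le]] := symmetric_merger_le_affine S_gt0 Fm Fsym.
exists c; split=> // x x0; apply/eqP; rewrite eq_le F_le//= leNgt.
apply/negP => F_lt; apply: Fmax; exists (fun x => 1 + c * excess x).
by split=> //; [exact: affine_pointwise_merger|exists x].
Qed.

End AdmissibleSymmetric.

Section CoherentFamily.
Context (R : realType).

(** Coordinates equal to 1 contribute nothing, so excess is the same on both
    sides of the coherence inequality. *)
Lemma excess_extend1 (B S : {fset nat}) (x : B -> R) :
  (B `<=` S)%fset -> excess (extend1 S x) = excess x.
Proof.
move=> BS; pose g (n : nat) : R := if insub n is Some j then x j - 1 else 0.
transitivity (\sum_(n <- S) g n).
  rewrite big_seq_fsetE; apply: eq_bigr => i _.
  by rewrite /extend1 /g; case: insubP => // _; rewrite subrr.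
rewrite -(big_fset_incl _ BS) => [|n _ nB]; last by rewrite /g insubN.
by rewrite big_seq_fsetE; apply: eq_bigr => i _; rewrite /g valK.
Qed.

Lemma excess_cst (S : {fset nat}) (a : R) :
  excess (fun _ : S => a) = #|` S|%:R * (a - 1).
Proof. by rewrite /excess sumr_const -cardfE mulr_natl. Qed.

(** The excess of a constant vector takes both signs (at the constants 0 and 2),
    so the one-sided coherence inequality yields equality of slopes. *)
Lemma coherent_affine_slope (I : set nat)
    (F : forall S : {fset nat}, (S -> R) -> R) (B S : {fset nat}) (b c : R) :
  coherent I F -> B != fset0 -> (B `<=` S)%fset -> fin_index I S ->
  (forall x : B -> R, orthant x -> F B x = 1 + b * excess x) ->
  (forall x : S -> R, orthant x -> F S x = 1 + c * excess x) ->
  b = c.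
Proof.
move=> Fcoh B0 BS IS FB FS.
have B_gt0 : 0 < #|` B|%:R :> R by rewrite ltr0n cardfs_gt0.
have slope_le (a : R) : 0 <= a ->
    b * (#|` B|%:R * (a - 1)) <= c * (#|` B|%:R * (a - 1)).
  move=> a0; have x0 : orthant (fun _ : B => a) by [].
  have := Fcoh B S B0 BS IS _ x0; rewrite FB// FS ?excess_extend1//.
    by rewrite excess_cst lerD2l.
  by move=> i; rewrite /extend1; case: insubP.
have := slope_le 0 (lexx _); have := slope_le 2 (ler0n _ _).
have -> : 2 - 1 = 1 :> R by ring.
rewrite sub0r mulr1 mulrN1 !mulrN lerN2 !ler_pM2r// => bc cb.
by apply/eqP; rewrite eq_le bc cb.
Qed.

End CoherentFamily.

Theorem corollary4p13 (R : realType) (I : set nat)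
    (F : forall S : {fset nat}, (S -> R) -> R)
    (Fadm : forall S : {fset nat}, fin_index I S -> admissible_merger (F S))
    (Fcoh : coherent I F)
    (Fsym : forall S : {fset nat}, fin_index I S -> symmetric_map (F S)) :
  (infinite_set I ->
     forall S : {fset nat}, fin_index I S ->
     forall x : S -> R, orthant x -> F S x = 1) /\
  (forall M : nat, (I #= `I_M)%card ->
     exists c : R,
       [/\ 0 <= c <= 1 / M%:R,
           forall S : {fset nat}, fin_index I S ->
             forall x : S -> R, orthant x ->
             F S x = 1 + c * \sum_(i : S) (x i - 1) &
           forall w : nat -> R, coordinate_weights I F w ->
             forall i, I i -> w i = c]).
Proof.
have F_affine (S : {fset nat}) : fin_index I S ->
    exists c : R, [/\ 0 <= c, c * #|` S|%:R <= 1 &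
      forall x : S -> R, orthant x -> F S x = 1 + c * excess x].
  move=> IS; rewrite cardfE; apply: admissible_symmetric_affine.
  - by case: IS => S0 _; rewrite -cardfE cardfs_gt0.
  - exact: Fadm.
  - exact: Fsym.
split=> [I_infinite S IS x x0|M IM].
  have [c [c0 cS FS]] := F_affine S IS.
  suff c_eq0 : c = 0 by rewrite FS// c_eq0 mul0r addr0.
  apply/eqP; rewrite eq_le c0 andbT leNgt; apply/negP => c_gt0.
  (* A finite set of more than [1 / c] indices contradicts [c * #|S| <= 1]. *)
  have [B BI Bcard] := infinite_set_fset (Num.bound c^-1) I_infinite.
  have [S0 SI] := IS.
  have IU : fin_index I (S `|` B)%fset.
    split; last by move=> n /=; rewrite inE => /orP[/SI|/BI].
    by apply/fset0Pn; case/fset0Pn: S0 => n nS; exists n; rewrite inE nS.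
  have [c' [_ c'U FU]] := F_affine _ IU.
  have c'c := coherent_affine_slope Fcoh S0 (fsubsetUl S B) IU FS FU.
  have : c^-1 < #|` (S `|` B)%fset|%:R.
    apply: lt_le_trans (archi_boundP _) _; first by rewrite invr_ge0.
    by rewrite ler_nat (leq_trans Bcard)// fsubset_leq_card// fsubsetUr.
  by rewrite ltNge -[_^-1]mul1r ler_pdivlMr// mulrC c'c c'U.
have I_finite : finite_set I by apply/finite_setP; exists M.
pose S0 := fset_set I.
have S0E : [set` S0] = I by exact: fset_setK.
have S0_card : #|` S0| = M by exact: cardinality.card_fset_set.
have sub_S0 (S : {fset nat}) : fin_index I S -> (S `<=` S0)%fset.
  by move=> [_ SI]; apply/fsubsetP => n /SI; rewrite /= in_fset_set// inE.
(* For [M = 0] the bound [1 / M] is [0], and no index set is nonempty. *)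
have [S0_eq0|S0_neq0] := eqVneq S0 fset0.
  have no_index (S : {fset nat}) : ~ fin_index I S.
    move=> IS; have := sub_S0 S IS; rewrite S0_eq0 fsubset0 => /eqP.
    by case: IS => /eqP.
  exists 0; split.
  - by rewrite lexx divr_ge0.
  - by move=> S /no_index.
  - by move=> w _ i; rewrite -S0E S0_eq0.
have IS0 : fin_index I S0 by split=> //; rewrite S0E.
have [c [c0 cM FS0]] := F_affine _ IS0.
rewrite S0_card in cM.
have F_slope (S : {fset nat}) : fin_index I S ->
    forall x : S -> R, orthant x -> F S x = 1 + c * excess x.
  move=> IS; have [c' [_ _ FS]] := F_affine _ IS; have [S_neq0 _] := IS.
  by rewrite -(coherent_affine_slope Fcoh S_neq0 (sub_S0 _ IS) IS0 FS FS0).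
exists c; split=> //.
  by rewrite c0 ler_pdivlMr// ltr0n -S0_card cardfs_gt0.
move=> w [_ _ Fw] i Ii.
have I1 : fin_index I [fset i]%fset.
  split; first by apply/fset0Pn; exists i; rewrite inE.
  by move=> j /=; rewrite inE => /eqP ->.
(* On a singleton the point 2 has excess 1, so the value of [F] there is 1 plus
   the slope in either representation. *)
have x0 : orthant (fun _ : [fset i]%fset => 2 : R) by move=> j.
have := Fw _ I1 _ x0; rewrite F_slope// /excess !big_fset1 /=.
by lra.
Qed.
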